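(* Let $T_0<T$ be reals, let $\rho:[T_0,T]\to\mathbb R$ be a non-negative absolutely continuous function and let $K_1,K_2,\varepsilon:[T_0,T]\to\mathbb R_+$ be non-negative Lebesgue integrable functions. Suppose that for some real constant $\epsilon>0$ $$\dot\rho(t)\le\varepsilon(t)+\epsilon+K_1(t)\rho(t)+K_2(t)\sqrt{\rho(t)}\int_{T_0}^{t}\sqrt{\rho(s)}\,ds\quad\text{for a.e. }t\in[T_0,T].$$ Then for all $t\in[T_0,T]$ $$\begin{aligned}\sqrt{\rho(t)}\le{}&\sqrt{\rho(T_0)+\epsilon}\,\exp\Big(\int_{T_0}^{t}(K(s)+1)\,ds\Big)+\frac{\sqrt\epsilon}{2}\int_{T_0}^{t}\exp\Big(\int_{s}^{t}(K(\tau)+1)\,d\tau\Big)ds\\&+2\Big(\sqrt{\int_{T_0}^{t}\varepsilon(s)\,ds+\epsilon}-\sqrt\epsilon\,\exp\Big(\int_{T_0}^{t}(K(\tau)+1)\,d\tau\Big)\Big)\\&+2\int_{T_0}^{t}(K(s)+1)\exp\Big(\int_{s}^{t}(K(\tau)+1)\,d\tau\Big)\sqrt{\int_{T_0}^{s}\varepsilon(\tau)\,d\tau+\epsilon}\;ds,\end{aligned}$$ where $K(t):=\max\big\{\frac{K_1(t)}{2},\frac{K_2(t)}{2}\big\}$ for a.e. $t\in[T_0,T]$.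
   Context: Here $\varepsilon(\cdot)$ is a function, whereas $\epsilon$ is a positive constant; they are unrelated. $\mathbb R_+=[0,+\infty)$. *)

(* Defs.v *)
From HB Require Import structures.
From mathcomp Require Export all_boot all_order all_algebra.
From mathcomp Require Export all_classical all_reals all_analysis.
Export Order.TTheory GRing.Theory Num.Theory.
Export numFieldNormedType.Exports.

Set Implicit Arguments.
Unset Strict Implicit.
Unset Printing Implicit Defensive.

Local Open Scope classical_set_scope.
Local Open Scope ring_scope.

(* The completed measure (i.e. on the Lebesgue sigma-algebra rather than the
   Borel one), so that "Lebesgue integrable" is not restricted to Borel
   functions. Its carrier type unfolds to [R]. *)
Notation lebmu R := (@completed_lebesgue_measure R).

Definition absolutely_continuous (R : realType) (a b : R) (f : R -> R) : Prop :=
  forall e : R, 0 < e -> exists2 d : R, 0 < d &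
    forall (n : nat) (u v : 'I_n -> R),
      (forall i, a <= u i /\ u i <= v i /\ v i <= b) ->
      trivIset [set: 'I_n] (fun i => `]u i, v i[%classic) ->
      \sum_(i < n) (v i - u i) < d ->
      \sum_(i < n) `|f (v i) - f (u i)| < e.

(* Main.v *)
From HB Require Import structures.
Require Import Defs.
From mathcomp Require Import measurable_realfun lebesgue_Rintegral lra ring.

(* Write E = int epsf + eps, y = sqrt (rho + E), z = int (sqrt rho) and
   A = int (K + 1), all integrals starting at T0. Almost everywhere
     y' <= epsf / sqrt E + sqrt eps / 2 + K (y + z),
   because y dominates sqrt rho, sqrt E and sqrt eps; hence y + z satisfies
     (y + z)' <= 2 (sqrt E)' + sqrt eps / 2 + (K + 1) (y + z),
   and the bound is Gronwall's inequality for y + z >= sqrt rho, the term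
   2 (sqrt E)' being integrated by parts. All the functions involved are
   absolutely continuous, so what is needed is that such functions are
   differentiable almost everywhere and are the integral of their derivative:
   the total variation of f is again absolutely continuous, which splits f into
   two nondecreasing absolutely continuous functions; the Lebesgue-Stieltjes
   measure of each is dominated by the Lebesgue measure, and its Radon-Nikodym
   density is the derivative, by Lebesgue's differentiation theorem. *)

Set Implicit Arguments.
Unset Strict Implicit.
Unset Printing Implicit Defensive.

Local Open Scope ring_scope.
Local Open Scope classical_set_scope.

(** * Absolute continuity and total variation *)

Section ac.
Context {R : realType}.
Implicit Types (a b : R) (f g h : R -> R) (p q : R * R) (l : seq (R * R)).

Definition subitv a b p := [&& a <= p.1, p.1 <= p.2 & p.2 <= b].

Definition nonoverlap p q := (p.2 <= q.1) || (q.2 <= p.1).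

Definition vsum f l := \sum_(p <- l) `|f p.2 - f p.1|.

(** Finite families are lists here, so that they can be concatenated, filtered and refined, as the
    estimate of the total variation demands. *)
Definition ac a b f := forall e, 0 < e -> exists2 d, 0 < d &
  forall l, all (subitv a b) l -> pairwise nonoverlap l ->
    \sum_(p <- l) (p.2 - p.1) < d -> vsum f l < e.

Lemma nonoverlapC p q : nonoverlap p q = nonoverlap q p.
Proof. by rewrite /nonoverlap orbC. Qed.

Lemma ac_absolutely_continuous a b f : absolutely_continuous a b f -> ac a b f.
Proof.
move=> fac e /fac[d d0 H]; exists d => // l lab lno ld.
pose p (i : 'I_(size l)) := nth (a, a) l i.
have pl i : p i \in l by exact: mem_nth.
have lE (F : R * R -> R) : \sum_(q <- l) F q = \sum_(i < size l) F (p i).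
  by rewrite (big_nth (a, a)) big_mkord.
rewrite /vsum lE; apply: (H (size l) (fst \o p) (snd \o p)).
- by move=> i /=; have /allP/(_ _ (pl i))/and3P[] := lab.
- move=> i j _ _ /= [x [/=]]; rewrite !in_itv/= => /andP[xi ix] /andP[xj jx].
  apply/eqP; apply: contraT => ij.
  have : nonoverlap (p i) (p j).
    move/(pairwiseP (a, a)) : lno => lno.
    move: ij; rewrite -val_eqE neq_ltn => /orP[|] ij; last rewrite nonoverlapC.
      by apply: lno => //; rewrite inE.
    by apply: lno => //; rewrite inE.
  by rewrite /nonoverlap => /orP[|] ?; lra.
- by rewrite -(lE (fun q => q.2 - q.1)).
Qed.

Lemma acS a b c f : c <= b -> ac a b f -> ac a c f.
Proof.
move=> cb fac e /fac[d d0 H]; exists d => // l /allP lac; apply: H.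
by apply/allP => p /lac /and3P[? ? pc]; apply/and3P; split=> //; lra.
Qed.

(** The common source of the closure properties below: sums, products and compositions with
    Lipschitz functions all have increments controlled by those of their arguments. *)
Lemma ac_dom a b (C : R) f g h : ac a b f -> ac a b g ->
  (forall u v, a <= u -> u <= v -> v <= b ->
    `|h v - h u| <= C * (`|f v - f u| + `|g v - g u|)) -> ac a b h.
Proof.
move=> fac gac H e e0.
(* [C] may be zero or negative, so [|C| + 1] serves as the positive divisor. *)
have M0 : 0 < `|C| + 1 by rewrite ltr_wpDl.
have e1 : 0 < e / (`|C| + 1) / 2 by rewrite !divr_gt0.
have [d1 d10 H1] := fac _ e1; have [d2 d20 H2] := gac _ e1.
exists (Num.min d1 d2); first by rewrite lt_min d10.
move=> l lab lno; rewrite lt_min.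
move=> /andP[/(H1 _ lab lno) ld1 /(H2 _ lab lno) ld2].
apply: (@le_lt_trans _ _ ((`|C| + 1) * (vsum f l + vsum g l))).
  rewrite /vsum -big_split/= mulr_sumr big_seq [leRHS]big_seq ler_sum//= => p pl.
  have /allP/(_ _ pl)/and3P[? ? ?] := lab.
  rewrite (le_trans (H _ _ _ _ _))// ler_wpM2r ?addr_ge0//.
  by rewrite (le_trans (ler_norm _))// lerDl.
rewrite -ltr_pdivlMl// mulrC; move: ld1 ld2; lra.
Qed.

Lemma acD a b f g : ac a b f -> ac a b g -> ac a b (f \+ g).
Proof.
move=> fac gac; apply: (ac_dom (C := 1) fac gac) => u v _ _ _ /=.
by rewrite mul1r opprD addrACA ler_normD.
Qed.

Lemma acB a b f g : ac a b f -> ac a b g -> ac a b (f \- g).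
Proof.
move=> fac gac; apply: (ac_dom (C := 1) fac gac) => u v _ _ _ /=.
rewrite mul1r; have -> : f v - g v - (f u - g u) = f v - f u - (g v - g u) by ring.
exact: ler_normB.
Qed.

Lemma ac_lipschitz a b (C : R) f h : ac a b f ->
  (forall u v, a <= u -> u <= v -> v <= b ->
    `|h v - h u| <= C * `|f v - f u|) -> ac a b h.
Proof.
move=> fac H; apply: (ac_dom (C := `|C|) fac fac) => u v au uv vb.
rewrite (le_trans (H _ _ au uv vb))// mulrDr ler_wpDr ?mulr_ge0//.
by rewrite ler_wpM2r// ler_norm.
Qed.

Lemma acZ a b (k : R) f : ac a b f -> ac a b (fun x => k * f x).
Proof.
move=> fac; apply: (ac_lipschitz (C := `|k|) fac) => u v _ _ _ /=.
by rewrite -mulrBr normrM.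
Qed.

Lemma ac_cst a b (k : R) : ac a b (cst k).
Proof.
move=> e e0; exists 1 => // l _ _ _; rewrite /vsum big1// => p _.
by rewrite subrr normr0.
Qed.

(** Pairing consecutive points turns a partition into a list of adjacent intervals, the form in
    which [ac] can be applied to it. *)
Lemma zip_itv_partition a b s : itv_partition a b s ->
  let l := zip (a :: s) s in
  [/\ all (subitv a b) l, pairwise nonoverlap l,
     \sum_(p <- l) (p.2 - p.1) = b - a &
     forall f, variation a b f s = vsum f l].
Proof.
elim: s a => [a|x s IH a].
  by case=> _ /eqP /= ->; split => //=; rewrite ?big_nil ?subrr// => f;
     rewrite variation_nil/vsum ?big_nil.
move=> axs /=; have xs := itv_partition_cons axs.
have ax : a < x by case: axs => /= /andP[].
have xb := itv_partition_le xs.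
have [al pl sl vl] := IH _ xs; split.
- rewrite /subitv/= lexx (ltW ax) xb/=.
  by apply: sub_all al => p /and3P[? ? ?]; apply/and3P; split => //; lra.
- rewrite pl andbT; apply: sub_all al => p /and3P[? ? ?].
  by rewrite /nonoverlap/=; apply/orP; left.
- by rewrite big_cons sl/=; lra.
- move=> f; rewrite /vsum big_cons -/(vsum f _) -vl/=.
  by rewrite /variation/= big_nat_recl.
Qed.

Lemma nonoverlap_subitv a b q l : nonoverlap (a, b) q -> all (subitv a b) l ->
  all (nonoverlap q) l.
Proof.
rewrite /nonoverlap/= => abq; apply: sub_all => p /and3P[? ? ?].
by apply/orP; move: abq => /orP[?|?]; [right|left]; lra.
Qed.

Local Notation TV := total_variation.

(* Every interval whose total variation is still to be estimated is traded for
   the intervals of one of its partitions. *)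
Lemma sum_total_variation_le a b f (d e : R) :
  (forall l, all (subitv a b) l -> pairwise nonoverlap l ->
    \sum_(p <- l) (p.2 - p.1) < d -> vsum f l <= e) ->
  forall l1 l2, all (subitv a b) (l1 ++ l2) -> pairwise nonoverlap (l1 ++ l2) ->
    \sum_(p <- l1 ++ l2) (p.2 - p.1) < d ->
    (\sum_(p <- l1) TV p.1 p.2 f + (vsum f l2)%:E <= e%:E)%E.
Proof.
move=> H; elim=> [|[u v] l1 IH] l2.
  by rewrite big_nil add0e lee_fin; exact: H.
rewrite big_cons/= => /andP[/and3P[/= au uv vb] abl] /andP[uvl pl].
rewrite big_cons/= => ld.
set r := (\sum_(p <- l1) TV p.1 p.2 f + (vsum f l2)%:E)%E.
(* A partition of the first interval is moved into [l2]: the total length is unchanged and the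
   family stays nonoverlapping, so the induction hypothesis applies. The supremum over [s] is taken
   at the end. *)
have key s : itv_partition u v s -> (r + (variation u v f s)%:E <= e%:E)%E.
  move=> /zip_itv_partition; set s' := zip _ _ => -[uvs ps ds vs].
  have abs : all (subitv a b) s'.
    by apply: sub_all uvs => p /and3P[? ? ?]; apply/and3P; split => //; lra.
  have sl q : q \in l1 ++ l2 -> all (nonoverlap q) s'.
    by move=> /(allP uvl)/nonoverlap_subitv; apply.
  rewrite vs /r -addeA -EFinD /vsum -big_cat/= -/(vsum f _); apply: IH.
  - by move: abl; rewrite !all_cat abs andbT.
  - move: pl; rewrite !pairwise_cat => /and3P[p12 -> ->].
    rewrite ps allrel_catr p12/= !andbT; apply/andP; split.
    + by apply/allrelP => p q p1; apply/allP/sl; rewrite mem_cat p1.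
    + by apply/allrelP => p q p2; apply/allP/sl; rewrite mem_cat p2 orbT.
  - move: ld; rewrite !big_cat/= ds; lra.
have r0 : (0 <= r)%E.
  rewrite /r adde_ge0 ?lee_fin ?sumr_ge0// big_seq sume_ge0//= => p pl1.
  rewrite total_variation_ge0//.
  by move: abl; rewrite all_cat => /andP[/allP/(_ _ pl1)/and3P[]].
(* Partitions are strictly increasing, so a degenerate interval admits only the empty one and is
   treated apart. *)
have [uv'|uv'] := eqVneq u v.
  have := key [::]; rewrite uv' total_variationxx variation_nil adde0/r add0e.
  by apply; split.
have {uv'}uv' : u < v by rewrite lt_neqAle uv'.
(* Finiteness, read off from the one-piece partition, allows [r] to be subtracted before passing to
   the supremum. *)
have rfin : r \is a fin_num.
  rewrite ge0_fin_numE// (@le_lt_trans _ _ e%:E) ?ltry//.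
  apply: le_trans (key [:: v] _); last exact: itv_partition1.
  by rewrite leeDl// lee_fin variation_ge0.
rewrite -addeA -/r -leeBrDr//; apply: ge_ereal_sup => _ [_ [s uvs <-] <-].
by rewrite leeBrDr// addeC key.
Qed.

Lemma ac_total_variation_sum a b f : ac a b f -> forall e, 0 < e ->
  exists2 d, 0 < d & forall l, all (subitv a b) l -> pairwise nonoverlap l ->
  \sum_(p <- l) (p.2 - p.1) < d -> (\sum_(p <- l) TV p.1 p.2 f <= e%:E)%E.
Proof.
move=> fac e /fac[d d0 H]; exists d => // l abl lno ld.
rewrite -[leLHS]adde0.
have := @sum_total_variation_le a b f d e _ l [::]; rewrite cats0 /vsum big_nil.
by apply => // l' ? ? ?; apply/ltW/H.
Qed.

(** An interval shorter than the [d] associated with 1 has variation at most 1, and finitely many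
    steps of length [d / 2] cover [[a, b]]. *)
Lemma ac_bounded_variation a b f : a <= b -> ac a b f -> bounded_variation a b f.
Proof.
move=> ab /ac_total_variation_sum/(_ _ ltr01)[d d0 H].
suff {ab} step n x : a <= x -> x <= b -> x - a <= d / 2 *+ n ->
    TV a x f \is a fin_num.
  apply/bounded_variationP => //.
  apply: (step (Num.bound ((b - a) / (d / 2)))) => //.
  rewrite -mulr_natr -ler_pdivrMl ?divr_gt0// mulrC ltW//.
  by rewrite archi_boundP// !divr_ge0 ?subr_ge0// ltW.
elim: n x => [|n IH] x ax xb xn.
  have -> : x = a by move: xn; rewrite mulr0n; lra.
  by rewrite total_variationxx.
(* One step back from [x], stopped at [a]: the last piece has variation at most 1 and the rest needs
   only [n] steps. *)
pose y := Num.max a (x - d / 2).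
have ay : a <= y by rewrite le_max lexx.
have yx : y <= x by rewrite ge_max ax/= lerBlDr lerDl divr_ge0// ltW.
have xy : x - y <= d / 2 by rewrite lerBlDr -lerBlDl le_max lexx orbT.
rewrite (total_variationD f ay yx) fin_numD IH//=; last 2 first.
- exact: le_trans xb.
- move: xn; rewrite /y mulrS => xn; rewrite lerBlDr ge_max; apply/andP; split.
    by rewrite lerDr mulrn_wge0// divr_ge0// ltW.
  lra.
rewrite ge0_fin_numE ?total_variation_ge0// (@le_lt_trans _ _ 1%:E) ?ltry//.
have := H [:: (y, x)]; rewrite !big_seq1/= /subitv/= ay yx xb/=; apply => //.
lra.
Qed.

Lemma ac_bounded a b f : a <= b -> ac a b f ->
  exists M, forall x, a <= x -> x <= b -> `|f x| <= M.
Proof.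
move=> ab fac; have [M HM] := ac_bounded_variation ab fac.
have M0 : TV a b f \is a fin_num.
  by apply/bounded_variationP => //; exact: ac_bounded_variation.
exists (`|f a| + fine (TV a b f)) => x ax xb.
rewrite -[f x](subrK (f a)) addrC (le_trans (ler_normD _ _))// lerD2l.
rewrite -lee_fin fineK//.
rewrite (le_trans (total_variation_ge f ax))// (total_variationD f ax xb).
by rewrite leeDl// total_variation_ge0.
Qed.

Lemma acM a b f g : a <= b -> ac a b f -> ac a b g -> ac a b (f \* g).
Proof.
move=> ab fac gac.
have [M HM] := ac_bounded ab fac; have [N HN] := ac_bounded ab gac.
apply: (ac_dom (C := Num.max M N) fac gac) => u v au uv vb /=.
have -> : f v * g v - f u * g u = f v * (g v - g u) + g u * (f v - f u) by ring.
have av := le_trans au uv; have ub := le_trans uv vb.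
rewrite addrC (le_trans (ler_normD _ _))// !normrM mulrDr.
by rewrite lerD// ler_wpM2r// le_max ?HM ?HN ?orbT.
Qed.

(** [fine] sends an infinite variation to 0, so this is the variation function only when [f] has
    bounded variation. *)
Definition fTV a f x := fine (TV a x f).

Lemma fTVD a b f x y : bounded_variation a b f -> a <= x -> x <= y -> y <= b ->
  (fTV a f y - fTV a f x)%:E = TV x y f.
Proof.
move=> bv ax xy yb; have ay := le_trans ax xy.
have bay := bounded_variationl ay yb bv; have bax := bounded_variationl ax xy bay.
have bxy := bounded_variationr ax xy bay.
rewrite /fTV (total_variationD f ax xy) fineD; last 2 first.
- by apply/bounded_variationP.
- by apply/bounded_variationP.
by rewrite addrC addKr fineK//; apply/bounded_variationP.
Qed.

Lemma fTV_ge a b f x y : bounded_variation a b f -> a <= x -> x <= y -> y <= b ->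
  `|f y - f x| <= fTV a f y - fTV a f x.
Proof.
by move=> bv ax xy yb; rewrite -lee_fin (fTVD bv)// total_variation_ge.
Qed.

Lemma ac_fTV a b f : a <= b -> ac a b f -> ac a b (fTV a f).
Proof.
move=> ab fac e e0; have bv := ac_bounded_variation ab fac.
(* Passing to suprema has left a non-strict bound; half of [e] restores the strict one. *)
have [d d0 H] := ac_total_variation_sum fac (divr_gt0 e0 (ltr0n _ 2)).
exists d => // l abl lno /(H _ abl lno) le2.
apply: (@le_lt_trans _ _ (e / 2)); last by rewrite ltr_pdivrMr// ltr_pMr// ltr1n.
rewrite -lee_fin; apply: le_trans le2; rewrite /vsum -sumEFin.
rewrite big_seq [leRHS]big_seq lee_sum//= => p pl.
have /allP/(_ _ pl)/and3P[ap pp pb] := abl.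
rewrite -(fTVD bv ap pp pb) lee_fin ger0_norm//.
by rewrite (le_trans _ (fTV_ge bv ap pp pb)).
Qed.

End ac.

(** * The fundamental theorem for absolutely continuous functions *)

Section monotone.
Context {R : realType}.
Variables (a b : R) (F : R -> R).
Hypotheses (ab : a < b) (Fac : ac a b F)
  (Fnd : forall x y, a <= x -> x <= y -> y <= b -> F x <= F y).
Let mu : measure _ _ := @lebesgue_measure R.

(** The retraction of the line onto [[a, b]]. Composed with it, [F] becomes nondecreasing and
    right-continuous on the whole line, hence defines a Lebesgue-Stieltjes measure. *)
Let clip x := Num.max a (Num.min b x).

Let clip_id x : a <= x -> x <= b -> clip x = x.
Proof. by move=> ax xb; rewrite /clip (min_r xb) (max_r ax). Qed.

Let clip_bnd x : a <= clip x /\ clip x <= b.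
Proof. by rewrite /clip le_max lexx ge_max ge_min lexx (ltW ab). Qed.

Let clip_le x y : x <= y -> clip x <= clip y /\ clip y - clip x <= y - x.
Proof.
move=> xy; rewrite /clip.
case: (leP b x) => bx; case: (leP b y) => yb; rewrite ?(max_r (ltW ab)).
- by split; lra.
- by move: (lt_le_trans yb bx); lra.
- by case: (leP a x) => ax; have := ab; split; lra.
- by case: (leP a x) => ax; case: (leP a y) => ay; have := ab; split; lra.
Qed.

Let Fc x := F (clip x).

Let Fc_nondecreasing : nondecreasing Fc.
Proof.
move=> x y /clip_le[xy _].
by apply: Fnd => //; [exact: (clip_bnd x).1|exact: (clip_bnd y).2].
Qed.

Let Fc_right_continuous : right_continuous Fc.
Proof.
move=> x; apply/cvgrPdist_lt => e /Fac[d d0 H]; near=> t.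
have [xt txd] : x <= t /\ t < x + d.
  split; near: t; first exact: nbhs_right_ge.
  by apply: nbhs_right_lt; rewrite ltrDl.
have [c1 c2] := clip_le xt.
have := H [:: (clip x, clip t)]; rewrite /vsum !big_seq1/= /subitv/= c1.
by rewrite (clip_bnd _).1 (clip_bnd _).2/= distrC; apply => //; lra.
Unshelve. all: by end_near. Qed.

HB.instance Definition _ :=
  isCumulative.Build R _ R Fc Fc_nondecreasing Fc_right_continuous.

Let LS : measure _ _ := lebesgue_stieltjes_measure Fc.

Let LS_itv u v : u <= v -> LS `]u, v] = (Fc v - Fc u)%:E.
Proof.
move=> uv; rewrite /LS/= /lebesgue_stieltjes_measure /measure_extension.
by rewrite measurable_mu_extE/= ?wlength_itv_bnd//; exact: is_ocitv.
Qed.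

Let LS_itvoo u v : u <= v -> (LS `]u, v[ <= (Fc v - Fc u)%:E)%E.
Proof.
move=> uv; rewrite -LS_itv//; apply: le_measure.
- by apply: mem_set; exact: measurable_itv.
- by apply: mem_set; exact: measurable_itv.
- exact: subset_itv_oo_oc.
Qed.

(* Each component of the open set is traded for its trace on [a, b]. *)
Let LS_open (V : set R) (d e : R) : open V -> V `<=` `]a, b + 1[ ->
  (mu V < d%:E)%E ->
  (forall l, all (subitv a b) l -> pairwise nonoverlap l ->
    \sum_(p <- l) (p.2 - p.1) < d -> vsum F l < e) ->
  (LS V <= e%:E)%E.
Proof.
move=> oV Vab Vd H.
have [I [oI tI VI]] := OpenSetDisjointItvs.open_disjoint_itv oV.
have mI k : measurable (I k) by apply: open_measurable; exact: (oI k).1.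
have IV k : I k `<=` V by rewrite VI; exact: bigcup_sup.
(* Each component is open, and bounded as a part of [V], so it is the open interval between its
   infimum and its supremum. *)
have IE k : I k = `]inf (I k), sup (I k)[%classic.
  have [oIk iIk] := oI k; rewrite -[LHS](interior_id _).1//.
  rewrite interval_bounded_interior// ?set_itvoo//.
    by exists a => x /IV/Vab/=; rewrite in_itv/= => /andP[/ltW].
  by exists (b + 1) => x /IV/Vab/=; rewrite in_itv/= => /andP[_ /ltW].
pose p k := (clip (inf (I k)), clip (sup (I k))).
have pI k : (p k).1 < (p k).2 ->
  [/\ subitv a b (p k), `](p k).1, (p k).2[%classic `<=` I k,
    (((p k).2 - (p k).1)%:E <= mu (I k))%E &
    (LS (I k) <= (F (p k).2 - F (p k).1)%:E)%E].
  rewrite /p/=; set u := inf _; set v := sup _ => cuv.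
  have uv : u < v by rewrite ltNge; apply/negP => /clip_le; lra.
  have [c1 c2] := clip_le (ltW uv); split.
  - by rewrite /subitv/= (clip_bnd _).1 c1 (clip_bnd _).2.
  - move=> x; rewrite /= in_itv/= gt_max gt_min lt_max lt_min.
    rewrite IE -/u -/v /= in_itv/= => /andP[/andP[ax bux] /orP[xa|/andP[xb ->]]].
      by move: (lt_trans ax xa); rewrite ltxx.
    by rewrite andbT; move: bux => /orP[bx|//]; move: (lt_trans xb bx); rewrite ltxx.
  - rewrite IE -/u -/v /mu lebesgue_measure_itv/= lte_fin uv lee_fin; lra.
  - by rewrite IE -/u -/v LS_itvoo// ltW.
(* If the trace is degenerate, [Fc] takes the same value at both ends of the component, which
   therefore carries no mass. *)
have pI0 k : (p k).1 < (p k).2 = false -> LS (I k) = 0%E.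
  rewrite /p/=; set u := inf _; set v := sup _ => cuv.
  rewrite IE -/u -/v; have [uv|vu] := ltP u v; last first.
    by rewrite set_itv_ge ?measure0// bnd_simp -leNgt.
  apply/eqP; rewrite eq_le measure_ge0 andbT.
  apply: (le_trans (LS_itvoo (ltW uv))); rewrite lee_fin subr_le0 /Fc.
  have [c1 c2] := clip_le (ltW uv); move/negbT: cuv; rewrite -leNgt => vu.
  by rewrite (@le_anti _ _ (clip u) (clip v))// c1.
(* The nondegenerate traces of the first [n] components; the others are null for [LS]. *)
pose l n := [seq q <- [seq p k | k <- index_iota 0 n] | q.1 < q.2].
have lE n (G : R * R -> R) :
    \sum_(q <- l n) G q = \sum_(0 <= k < n | (p k).1 < (p k).2) G (p k).
  by rewrite big_filter big_map.
have muV n : (\sum_(0 <= k < n) mu (I k) <= mu V)%E.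
  have <- : (\sum_(0 <= k <oo) mu (I k) = mu V)%E.
    by rewrite VI; apply/cvg_lim => //; exact: measure_sigma_additive.
  exact: nneseries_lim_ge.
have Hl n : \sum_(q <- l n) (F q.2 - F q.1) <= e.
  apply: le_trans (ltW (H (l n) _ _ _)).
  - by rewrite /vsum ler_sum// => q _; exact: ler_norm.
  - apply/allP => q; rewrite mem_filter => /andP[q12 /mapP[k _ qk]].
    by move: q12; rewrite qk => /pI[].
  - rewrite /l filter_map pairwise_map.
    pose P k := (p k).1 < (p k).2.
    apply: (@sub_in_pairwise _ P (fun x y => x != y)).
    + move=> j k; rewrite /P !unfold_in => jP kP /= jk.
      have [_ jI _ _] := pI j jP; have [_ kI _ _] := pI k kP.
      apply: contraT; rewrite /nonoverlap negb_or -!ltNge => /andP[kj1 jk1].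
      (* Two overlapping traces share the midpoint of their intersection, against the disjointness
         of the components. *)
      pose x := (Num.max (p j).1 (p k).1 + Num.min (p j).2 (p k).2) / 2.
      have xjk : Num.max (p j).1 (p k).1 < Num.min (p j).2 (p k).2.
        by rewrite gt_max !lt_min jP kP kj1 jk1.
      have /andP[/andP[xj xk] /andP[jx kx]] :
          ((p j).1 < x) && ((p k).1 < x) && ((x < (p j).2) && (x < (p k).2)).
        by rewrite -gt_max -lt_min; have [x1 x2] := midf_lt xjk; apply/andP.
      suff : j = k by move/eqP; rewrite (negbTE jk).
      by apply: (tI j k) => //; exists x; split; [apply: jI|apply: kI];
        rewrite /= in_itv/= ?xj ?xk.
    + by apply/allP => k; rewrite mem_filter => /andP[].
    + by rewrite -uniq_pairwise filter_uniq// iota_uniq.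
  - rewrite -lte_fin; apply: le_lt_trans Vd; apply: le_trans (muV n).
    rewrite lE -sumEFin [leRHS](bigID (fun k => (p k).1 < (p k).2))/=.
    rewrite -[leLHS]adde0 leeD//; first by apply: lee_sum => k /pI[].
    by apply: sume_ge0 => k _; exact: measure_ge0.
rewrite VI.
have LSI := @measure_sigma_additive _ _ _ LS I mI tI.
rewrite -(cvg_lim _ LSI)//; apply: lime_le.
  by apply/cvg_ex; eexists; exact: LSI.
apply: nearW => n.
rewrite (bigID (fun k => (p k).1 < (p k).2))/= [X in (_ + X)%E]big1 ?adde0;
  last first.
  by move=> k /negbTE/pI0.
apply: (@le_trans _ _ (\sum_(q <- l n) (F q.2 - F q.1))%:E); last first.
  by rewrite lee_fin.
by rewrite lE -sumEFin; apply: lee_sum => k /pI[].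
Qed.

(** Outer regularity encloses the null set in an open set of Lebesgue measure below [d], whose
    Stieltjes measure is then at most [e]. *)
Let LS_dominates (N : set R) : measurable N -> mu N = 0%E ->
  LS (N `&` `]a, b]) = 0%E.
Proof.
move=> mN N0; apply/eqP; rewrite eq_le measure_ge0 andbT.
apply/lee_addgt0Pr => e e0; rewrite add0e.
have [d d0 H] := Fac e0.
have N00 : (mu N < +oo)%E by rewrite N0.
have [U [oU NU UN]] := lebesgue_regularity_outer mN N00 d0.
have mU := open_measurable oU.
(* The cut keeps [V] open and bounded; going beyond [b] keeps the endpoint [b] inside. *)
pose V := U `&` `]a, b + 1[.
have oV : open V by apply: openI => //; exact: interval_open.
have NV : N `&` `]a, b] `<=` V.
  move=> x [/NU Ux /=]; rewrite in_itv/= => /andP[ax xb]; split => //=.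
  by rewrite in_itv/= ax (le_lt_trans xb)// ltrDl.
apply: (@le_trans _ _ (LS V)).
  apply: le_measure => //; apply: mem_set.
    by apply: measurableI => //; exact: measurable_itv.
  exact: open_measurable.
apply: LS_open H => //; first by move=> x [].
apply: le_lt_trans UN; apply: (@le_trans _ _ (mu U)).
  apply: le_measure; last by move=> x [].
    by apply: mem_set; exact: open_measurable.
  exact: mem_set.
have : (mu U <= mu N + mu (U `\` N))%E.
  rewrite -[X in (mu X <= _)%E](setDUK NU).
  by apply: measureU2 => //; exact: measurableD.
by rewrite N0 add0e.
Qed.

Lemma nondecreasing_ac_density : exists g : R -> R,
  mu.-integrable setT (EFin \o g) /\
  (forall x, a <= x -> x <= b -> F x = F a + \int[mu]_(t in `]a, x]) g t).
Proof.
have mD : measurable (`]a, b] : set (measurableTypeR R)) by exact: measurable_itv.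
have LSD : (LS `]a, b] < +oo)%E by rewrite LS_itv ?ltW// ltry.
(* Restricting to []a, b]] makes the measure finite and confines it to where domination was
   proved. *)
pose nu : {finite_measure set _ -> \bar R} := mfrestr mD LSD.
have numu : nu `<< mu.
  by apply/null_content_dominatesP => A mA /LS_dominates; apply.
have [g [g0 gfin gint gE]] := radon_nikodym_sigma_finite numu.
exists (fine \o g); split.
  apply: eq_integrable gint => // x _ /=; by rewrite fineK.
move=> x ax xb; have mx : measurable (`]a, x] : set (measurableTypeR R)).
  exact: measurable_itv.
suff : (F x - F a)%:E = (\int[mu]_(t in `]a, x]) (fine (g t))%:E)%E.
  by rewrite /Rintegral => <- /=; ring.
under eq_integral do rewrite fineK//.
rewrite -gE//= /mfrestr /mrestr setIidl ?LS_itv//.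
  by rewrite /Fc !clip_id// ltW.
by apply: subset_itvl; rewrite bnd_simp.
Qed.

End monotone.

(** * Derivatives and integral representation of general absolutely continuous functions *)

Section ac_ftc.
Context {R : realType}.
Implicit Types (a b : R) (f g h : R -> R).
Notation mu := (@lebesgue_measure R).

#[local] Instance ae_lebesgue_filter : Filter (almost_everywhere mu) :=
  ae_filter_ringOfSetsType mu.

Lemma ae_and (P Q : R -> Prop) : {ae mu, forall x, P x} ->
  {ae mu, forall x, Q x} -> {ae mu, forall x, P x /\ Q x}.
Proof. by apply: filterS2. Qed.

Lemma ae_impl (P Q : R -> Prop) : (forall x, P x -> Q x) ->
  {ae mu, forall x, P x} -> {ae mu, forall x, Q x}.
Proof. by move=> PQ; apply: filterS. Qed.

Lemma integrable_sub_itv (D : set R) g : measurable D ->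
  mu.-integrable setT (EFin \o g) -> mu.-integrable D (EFin \o g).
Proof. by move=> mD; apply: integrableS. Qed.

(** Both the variation of [f] and its excess over [f] are nondecreasing and absolutely continuous;
    [g] is the difference of their densities. *)
Theorem ac_ftc a b f : a < b -> ac a b f -> exists g,
  [/\ mu.-integrable setT (EFin \o g),
   (forall x, a <= x -> x <= b -> f x = f a + \int[mu]_(t in `]a, x]) g t) &
   {ae mu, forall x, a < x < b -> is_derive x 1 f (g x)}].
Proof.
move=> ab fac; have bv := ac_bounded_variation (ltW ab) fac.
have Pac := ac_fTV (ltW ab) fac.
have [|gP [gPi gPE]] := nondecreasing_ac_density ab Pac.
  move=> x y ax xy yb.
  by have := fTV_ge bv ax xy yb; have := normr_ge0 (f y - f x); lra.
have [|gQ [gQi gQE]] := nondecreasing_ac_density ab (acB Pac fac).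
  move=> x y ax xy yb /=.
  by have := fTV_ge bv ax xy yb; have := ler_norm (f y - f x); lra.
pose g := gP \- gQ.
have gi : mu.-integrable setT (EFin \o g).
  have mT := @measurableT _ (measurableTypeR R).
  by have := integrableB mT gPi gQi; apply: eq_integrable => // x _ /=; rewrite EFinB.
have fE x : a <= x -> x <= b -> f x = f a + \int[mu]_(t in `]a, x]) g t.
  move=> ax xb; rewrite RintegralB//; last 2 first.
  - exact: integrable_sub_itv.
  - exact: integrable_sub_itv.
  by have := gPE _ ax xb; have := gQE _ ax xb => /=; lra.
exists g; split => //.
have := @FTC1 R g (BRight a) _ _.
have gint y : mu.-integrable [set` Interval (BRight a) (BRight y)] (EFin \o g).
  exact: integrable_sub_itv.
have gloc : locally_integrable [set: R] g.
  by apply: open_integrable_locally => //; exact: openT.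
move=> /(_ gint gloc); apply: ae_impl => x /= H /[dup] xab /andP[ax xb].
have [] := H ax.
set G := (fun x : R => _) => dG <-.
(* The integral formula for [f] holds only on [[a, b]], but an interior point has a neighbourhood
   there. *)
apply: (@near_eq_is_derive _ _ _ (cst (f a) \+ G)).
  have /near_in_itvoo : x \in `]a, b[%R by rewrite in_itv.
  by apply: filterS => y; rewrite in_itv/= => /andP[ay yb]; rewrite [RHS]fE ?ltW.
have dG' : is_derive x 1 G (G^`() x) by rewrite derive1E; exact: derivableP.
by rewrite -[X in is_derive _ _ _ X]add0r; exact: is_deriveD.
Qed.

(** The increment of [h] is the integral of a density that is almost everywhere a derivative.
    Quantifying over every possible derivative [d] spares the user any proof of
    differentiability. *)
Lemma ac_nonincreasing a b h : a <= b -> ac a b h ->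
  {ae mu, forall x, a < x < b -> forall d, is_derive x 1 h d -> d <= 0} ->
  h b <= h a.
Proof.
rewrite le_eqVlt => /predU1P[-> //|ab hac h0].
have [g [gi gE dg]] := ac_ftc ab hac.
rewrite (gE b (ltW ab) (lexx b)) gerDl -Rintegral_itv_bndo_bndc; last first.
  exact: integrable_sub_itv.
have : {ae mu, forall x, a < x < b -> g x <= 0}.
  by apply: ae_impl (ae_and h0 dg) => x [{}h0 {}dg] xab; exact: h0 xab _ (dg xab).
move=> [N [mN N0 HN]].
have mD : measurable (`]a, b[ : set (measurableTypeR R)) by exact: measurable_itv.
have mDN : measurable (`]a, b[ `\` N : set (measurableTypeR R)) by exact: measurableD.
(* Discarding the null set turns the almost everywhere bound into a pointwise one. *)
have -> : \int[mu]_(x in `]a, b[) g x = \int[mu]_(x in `]a, b[ `\` N) g x.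
  by congr fine; apply: negligible_integral => //; exact: integrable_sub_itv.
have <- : \int[mu]_(x in `]a, b[ `\` N) (cst 0 x) = 0.
  by rewrite Rintegral_cst// mul0r.
apply: le_Rintegral => //.
- exact: integrable_sub_itv.
- exact: integrable0.
- move=> x [xab Nx]; apply: contrapT => gx; apply/Nx/HN => /= H; apply: gx.
  by apply: H; move: xab; rewrite /= in_itv.
Qed.

(** [A] is the union of the half-open intervals, disjoint even when endpoints touch. The last clause
    keeps track of membership, so that disjointness survives the induction. *)
Lemma sum_Rintegral_nonoverlap g l : mu.-integrable setT (EFin \o g) ->
  pairwise nonoverlap l -> all (fun p => p.1 <= p.2) l ->
  exists A : set (measurableTypeR R), [/\ measurable A,
    \sum_(p <- l) \int[mu]_(t in `]p.1, p.2]) g t = \int[mu]_(t in A) g t,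
    (mu A <= (\sum_(p <- l) (p.2 - p.1))%:E)%E &
    forall x, A x -> exists2 p, p \in l & p.1 < x <= p.2].
Proof.
move=> gi; elim: l => [|p l IH].
  exists set0; split => //; rewrite ?big_nil ?Rintegral_set0 ?measure0//.
move=> /= /andP[/allP pl lno] /andP[p12 l12].
have [A [mA AE muA HA]] := IH lno l12.
have mp : measurable (`]p.1, p.2] : set (measurableTypeR R)) by exact: measurable_itv.
exists (`]p.1, p.2] `|` A); split.
- exact: measurableU.
- rewrite Rintegral_setU//.
  + by rewrite big_cons AE.
  + by apply: integrable_sub_itv => //; exact: measurableU.
  + apply/disj_setPS => x [/= + /HA[q /pl + /andP[qx xq]]].
    by rewrite in_itv/= => /andP[px xp] /orP[|]; lra.
- apply: (le_trans (measureU2 _ _ _)) => //.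
  rewrite big_cons EFinD; apply: leeD => //; rewrite /= lebesgue_measure_itv/= lte_fin.
  by case: ifP => //; rewrite lee_fin subr_ge0.
- move=> x [|/HA[q ql qx]]; last by exists q => //; rewrite inE ql orbT.
  by rewrite /= in_itv/= => px; exists p => //; rewrite inE eqxx.
Qed.

(** * Primitives of integrable functions *)

Definition primitive a g x := \int[mu]_(t in `[a, x]) g t.

(** Allows [g] to be replaced by a function integrable on the whole line. *)
Lemma primitive_restrict a b g x : x <= b ->
  primitive a g x = primitive a (g \_ `[a, b]) x.
Proof.
move=> xb; apply: eq_Rintegral => t; rewrite inE /= in_itv/= => /andP[at0 tx].
by rewrite /patch ifT// inE/= in_itv/= at0 (le_trans tx).
Qed.

Lemma primitiveB a g u v : mu.-integrable setT (EFin \o g) -> a <= u -> u <= v ->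
  primitive a g v - primitive a g u = \int[mu]_(t in `]u, v]) g t.
Proof.
by move=> gi au uv; apply: Rintegral_itvB => //; exact: integrable_sub_itv.
Qed.

Lemma integrable_restrict_setT a b g : mu.-integrable `[a, b] (EFin \o g) ->
  mu.-integrable setT (EFin \o (g \_ `[a, b])).
Proof.
have mD : measurable (`[a, b] : set (measurableTypeR R)) by exact: measurable_itv.
move/(integrable_mkcond _ mD); apply: eq_integrable => // x _.
by rewrite restrict_EFin.
Qed.

(** The increments add up to at most the integral of the norm over a set of small measure, which is
    small by absolute continuity of the integral. *)
Lemma ac_primitive a b g : mu.-integrable `[a, b] (EFin \o g) ->
  ac a b (primitive a g).
Proof.
move=> /integrable_restrict_setT; set g' := g \_ _ => gi e e0.
have [d [d0 H]] := integral_normr_continuous gi e0.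
have ngi : mu.-integrable setT (EFin \o (Num.norm \o g')).
  by have := integrable_norm gi.
exists d => // l /allP lab lno ld.
have l12 : all (fun p => p.1 <= p.2) l by apply/allP => p /lab/and3P[].
have [A [mA AE muA _]] := sum_Rintegral_nonoverlap ngi lno l12.
apply: (@le_lt_trans _ _ (\int[mu]_(t in A) `|g' t|)); last first.
  by apply: H => //; apply: le_lt_trans muA _; rewrite lte_fin.
rewrite -AE /vsum big_seq [leRHS]big_seq; apply: ler_sum => p /lab/and3P[ap pp pb].
rewrite !(@primitive_restrict a b g) ?(le_trans pp)//.
rewrite primitiveB//; apply: le_normr_Rintegral; first exact: measurable_itv.
by apply: integrable_sub_itv => //; exact: measurable_itv.
Qed.

Lemma is_derive_primitive a b g : mu.-integrable `[a, b] (EFin \o g) ->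
  {ae mu, forall x, a < x < b -> is_derive x 1 (primitive a g) (g x)}.
Proof.
move=> /integrable_restrict_setT; set g' := g \_ _ => gi.
have gint y : mu.-integrable [set` Interval (BLeft a) (BRight y)] (EFin \o g').
  exact: integrable_sub_itv.
have gloc : locally_integrable [set: R] g'.
  by apply: open_integrable_locally => //; exact: openT.
have := FTC1 gint gloc; apply: ae_impl => x /= H.
move=> /[dup] xab /andP[ax xb]; have [] := H ax.
set G := (fun x : R => _) => dG.
rewrite derive1E {1}/g' /patch ifT; last by rewrite inE/= in_itv/= !ltW.
move=> <-; apply: (@near_eq_is_derive _ _ _ G); last exact: derivableP.
have /near_in_itvoo : x \in `]a, b[%R by rewrite in_itv.
by apply: filterS => y; rewrite in_itv/= => /andP[ay yb];
   rewrite [RHS](@primitive_restrict a b) ?ltW.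
Qed.

End ac_ftc.

(** * Borel representatives for the completed Lebesgue measure *)

Section completion.
Context {R : realType}.
Notation mu := (@lebesgue_measure R).
Notation cmu := (@completed_lebesgue_measure R).
Notation cR := (caratheodory_type (wlength (@idfun R))^*%mu).

Lemma completed_negligibleE (N : set R) : cmu.-negligible N <-> mu.-negligible N.
Proof.
split=> [[A [mA A0 NA]]|[A [mA A0 NA]]].
  apply/negligible_outer_measure/eqP; rewrite eq_le outer_measure_ge0 andbT.
  by rewrite -A0; exact: le_outer_measure.
by exists A; split => //; exact: sub_caratheodory.
Qed.

Lemma completed_aeE (P : R -> Prop) :
  {ae cmu, forall x, P x} <-> {ae mu, forall x, P x}.
Proof. exact: completed_negligibleE. Qed.

(** The Caratheodory sigma-algebra is the completion of the Borel one. *)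
Lemma completed_measurableP (A : set cR) : measurable A ->
  exists B N : set (measurableTypeR R),
    [/\ measurable B, mu.-negligible N & A = B `|` N].
Proof.
rewrite -[measurable A]/((wlength idfun)^*%mu.-cara.-measurable A).
rewrite -completed_caratheodory_measurable g_sigma_completed_algebra_genE.
by move=> [B mB [N negN <-]]; exists B, N.
Qed.

Lemma completed_measurable_ae_eq (D : set R) (f g : R -> R) :
  measurable (D : set (measurableTypeR R)) ->
  measurable_fun (D : set (measurableTypeR R)) g ->
  {ae mu, forall x, D x -> f x = g x} -> measurable_fun (D : set cR) f.
Proof.
move=> mD mg /completed_aeE[N [mN N0 HN]] _ Y mY.
have -> : D `&` f @^-1` Y = (D `&` g @^-1` Y) `\` N `|` (D `&` f @^-1` Y `&` N).
  apply/seteqP; split => [x [Dx fx]|x [[[Dx gx] Nx]|[[]//]]].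
    have [Nx|Nx] := pselect (N x); first by right.
    left; split => //; split => //=; rewrite -(_ : f x = g x)//.
    by apply: contrapT => fg; apply/Nx/HN => /= /(_ Dx).
  split => //=; rewrite (_ : f x = g x)//.
  by apply: contrapT => fg; apply/Nx/HN => /= /(_ Dx).
apply: measurableU.
  apply: measurableD => //; apply: sub_caratheodory; exact: mg.
by apply: negligible_sub_caratheodory; exists N; split => // x [].
Qed.

(** The identity pushes the completed measure forward to the Borel one; change of variables settles
    nonnegative functions, then positive and negative parts are subtracted. *)
Lemma completed_integralE (D : set R) (f : R -> \bar R) :
  measurable (D : set (measurableTypeR R)) ->
  measurable_fun (D : set (measurableTypeR R)) f ->
  (\int[cmu]_(x in D) f x = \int[mu]_(x in D) f x)%E.
Proof.
move=> mD mf.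
have mid : measurable_fun [set: cR] (fun x : cR => x : measurableTypeR R).
  by move=> _ Y mY; rewrite setTI; exact: sub_caratheodory.
have ge0 (h : R -> \bar R) : measurable_fun (D : set (measurableTypeR R)) h ->
    (forall x, 0 <= h x)%E -> (\int[cmu]_(x in D) h x = \int[mu]_(x in D) h x)%E.
  move=> mh h0.
  have <- := ge0_integral_pushforward mid cmu mD mh (fun x _ => h0 x).
  exact: eq_measure_integral.
rewrite integralE [RHS]integralE; congr (_ - _)%E; apply: ge0 => //.
- exact: measurable_funepos.
- exact: measurable_funeneg.
Qed.

Lemma completed_integral_ae_eq (D : set R) (f g : R -> R) :
  measurable (D : set (measurableTypeR R)) ->
  measurable_fun (D : set (measurableTypeR R)) g ->
  {ae mu, forall x, D x -> f x = g x} ->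
  (\int[cmu]_(x in D) (f x)%:E = \int[mu]_(x in D) (g x)%:E)%E.
Proof.
move=> mD mg fg.
rewrite -completed_integralE//; last exact/measurable_EFinP.
apply: ae_eq_integral.
- exact: sub_caratheodory.
- by apply/measurable_EFinP; exact: completed_measurable_ae_eq fg.
- apply/measurable_EFinP; apply: (completed_measurable_ae_eq mD mg).
  by apply/completed_aeE; apply: aeW.
- move/completed_aeE : fg; apply: (@filterS _ _ (ae_filter_ringOfSetsType cmu)).
  by move=> x fg Dx; rewrite fg.
Qed.

(** Each set where [f] lies below a rational is Borel up to a negligible set. These countably many
    exceptions fit in one Borel null set [N'], on which the representative is set to 0. *)
Lemma completed_measurable_representative (f : R -> R) :
  measurable_fun [set: cR] f -> exists2 g : R -> R,
  measurable_fun [set: measurableTypeR R] g & {ae mu, forall x, f x = g x}.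
Proof.
move=> mf.
have H (q : rat) : exists BN : set (measurableTypeR R) * set (measurableTypeR R),
   [/\ measurable BN.1, mu.-negligible BN.2 &
     f @^-1` `]-oo, ratr q[ = BN.1 `|` BN.2].
  have := mf (@sub_caratheodory _ _ _ _ _ measurableT) _
    (measurable_itv `]-oo, ratr q[%R).
  by rewrite setTI => /completed_measurableP[B [N [mB N0 E]]]; exists (B, N).
have [BN HBN] := choice H.
pose N n := if unpickle n is Some q then (BN q).2 else set0.
have [N' [mN' N'0 NN']] : mu.-negligible (\bigcup_n N n).
  apply: negligible_bigcup => n; rewrite /N; case: unpickle => [q|].
    by have [] := HBN q.
  exact: negligible_set0.
have NqN' q : (BN q).2 `<=` N'.
  move=> x Nx; apply: NN'; exists (pickle q); first exact: Logic.I.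
  by rewrite /N pickleK.
pose g x := if x \in N' then 0 else f x.
exists g; last first.
  exists N'; split => // x /= fg; apply: contrapT => Nx; apply: fg.
  by rewrite /g memNset.
apply: (measurability _ (RGenInftyO.measurableE R)) => //.
move=> _ [_ [r ->] <-]; rewrite setTI.
(* Rationals between [f x] and [r] recover the sublevel set off [N']; on [N'] the value 0 lies below
   [r] exactly when [0 < r]. *)
have -> : g @^-1` `]-oo, r[ =
    (\bigcup_(q in [set q | ratr q < r]) ((BN q).1 `\` N')) `|`
    (if 0 < r then N' else set0).
  apply/seteqP; split => [x|x].
    rewrite /= in_itv/= /g; case: ifPn => [/set_mem xN r0|/negP xN fr].
      by right; rewrite r0.
    have [q] := rat_in_itvoo fr; rewrite in_itv/= => /andP[fq qr].
    left; exists q => //; split; last by move=> /mem_set.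
    have [_ _ E] := HBN q.
    have : (f @^-1` `]-oo, ratr q[) x by rewrite /= in_itv.
    by rewrite E => -[//|/NqN'/mem_set].
  move=> [[q /= qr [Bx Nx]]|].
    rewrite in_itv/= /g memNset//; apply: lt_trans qr.
    have [_ _ E] := HBN q.
    have : (f @^-1` `]-oo, ratr q[) x by rewrite E; left.
    by rewrite /= in_itv.
  by case: ifPn => // r0 xN; rewrite /= in_itv/= /g mem_set.
apply: measurableU; last by case: ifP.
rewrite bigcup_mkcond; apply: bigcupT_measurable_rat => q; case: ifP => // _.
by apply: measurableD => //; have [] := HBN q.
Qed.

Lemma completed_integrable_representative (D : set R) (f : R -> R) :
  measurable (D : set (measurableTypeR R)) ->
  cmu.-integrable D (EFin \o f) -> (forall x, D x -> 0 <= f x) ->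
  exists g : R -> R, [/\ measurable_fun [set: measurableTypeR R] g,
    mu.-integrable D (EFin \o g), forall x, 0 <= g x &
    {ae mu, forall x, D x -> f x = g x}].
Proof.
move=> mD /integrableP[mf foo] f0.
have cmD : measurable (D : set cR) by exact: sub_caratheodory.
have /completed_measurable_representative[g mg fg] : measurable_fun [set: cR] (f \_ D).
  by apply/(measurable_restrictT _ cmD)/measurable_EFinP.
(* The positive part makes the representative nonnegative everywhere, and changes nothing almost
   everywhere on [D]. *)
have mg0 : measurable_fun [set: measurableTypeR R] (fun x => Num.max (g x) 0).
  by apply: measurable_maxr.
have fg0 : {ae mu, forall x, D x -> f x = Num.max (g x) 0}.
  apply: ae_impl fg => x fg Dx.
  by move: fg; rewrite /patch mem_set// => <-; rewrite max_l// f0.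
exists (fun x => Num.max (g x) 0); split => //.
  apply/integrableP; split; first by apply/measurable_EFinP; exact: measurable_funTS.
  rewrite (le_lt_trans _ foo)//.
  under eq_integral do rewrite /= -/(EFin _).
  rewrite -(@completed_integral_ae_eq D (fun x => `|f x|))//.
    by apply: measurableT_comp => //; exact: measurable_funTS.
  by apply: ae_impl fg0 => x fg0 Dx; rewrite fg0.
by move=> x; rewrite le_max lexx orbT.
Qed.

End completion.

(** * The Gronwall estimate *)

Section gronwall.
Context {R : realType}.
Notation mu := (@lebesgue_measure R).

Lemma ac_continuous (a b : R) f : ac a b f -> {within `[a, b], continuous f}.
Proof.
move=> fac; apply/subspace_continuousP => x; rewrite /= in_itv/= => /andP[ax xb].
apply/cvgrPdist_lt => e /fac[d d0 H].
have {}H u v : a <= u -> u <= b -> a <= v -> v <= b ->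
    `|u - v| < d -> `|f u - f v| < e.
  wlog uv : u v / u <= v => [th au ub av vb|au _ _ vb]; last first.
    move=> uvd; have := H [:: (u, v)].
    rewrite /vsum !big_seq1/= /subitv/= au uv vb distrC; apply => //.
    by rewrite (le_lt_trans _ uvd)// distrC ler_norm.
  have [uv|/ltW vu] := leP u v; first exact: th.
  by rewrite distrC [X in _ -> X < _]distrC; exact: th.
rewrite near_withinE; near=> y => /=; rewrite in_itv/= => /andP[ay yb].
by apply: H => //; near: y; exact: cvgr_dist_lt.
Unshelve. all: by end_near. Qed.

Lemma ac_integrable (a b : R) f : ac a b f -> mu.-integrable `[a, b] (EFin \o f).
Proof.
move=> /ac_continuous; apply: continuous_compact_integrable.
exact: segment_compact.
Qed.

(** Continuity suffices here; near zeros of [f] the square root may lose absolute continuity. *)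
Lemma ac_sqrt_integrable (a b : R) f : ac a b f ->
  mu.-integrable `[a, b] (EFin \o (Num.sqrt \o f)).
Proof.
move=> fac; apply: continuous_compact_integrable; first exact: segment_compact.
move=> x; apply: (@continuous_comp _ _ _ (f : subspace `[a, b] -> R) Num.sqrt).
  exact: ac_continuous.
exact: sqrt_continuous.
Qed.

Lemma integrableM_ac (a b : R) f g : a <= b -> mu.-integrable `[a, b] (EFin \o f) ->
  ac a b g -> mu.-integrable `[a, b] (EFin \o (f \* g)).
Proof.
move=> ab fi gac; have mD : measurable (`[a, b] : set (measurableTypeR R)).
  exact: measurable_itv.
have mg : measurable_fun (`[a, b] : set (measurableTypeR R)) g.
  by have /integrableP[/measurable_EFinP] := ac_integrable gac.
have gb : [bounded g x | x in (`[a, b] : set R)].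
  have [M HM] := ac_bounded ab gac; exists M; split; first exact: num_real.
  move=> N MN x; rewrite /= in_itv/= => /andP[ax xb].
  by rewrite (le_trans (HM _ ax xb))// ltW.
by have := integrableMl mD fi mg gb; apply: eq_integrable.
Qed.

Lemma primitive_ge0 (a : R) g x : (forall x, 0 <= g x) -> 0 <= primitive a g x.
Proof. by move=> g0; apply: Rintegral_ge0 => t _; exact: g0. Qed.

Lemma primitive_left (a : R) g : primitive a g a = 0.
Proof. by rewrite /primitive set_itv1 Rintegral_set1. Qed.

(** The square root is Lipschitz away from 0. This is why [rho + E], bounded below by [eps], is used
    in place of [rho]. *)
Lemma ac_sqrt (a b c : R) f : 0 < c -> ac a b f ->
  (forall x, a <= x -> x <= b -> c <= f x) -> ac a b (Num.sqrt \o f).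
Proof.
move=> c0 fac cf; apply: (ac_lipschitz (C := (Num.sqrt c)^-1) fac) => u v au uv vb /=.
have cu := cf _ au (le_trans uv vb); have cv := cf _ (le_trans au uv) vb.
have s0 : 0 < Num.sqrt c by rewrite sqrtr_gt0.
have su : Num.sqrt c <= Num.sqrt (f u) by exact: ler_wsqrtr.
rewrite ler_pdivlMl//.
have -> : f v - f u =
    (Num.sqrt (f v) + Num.sqrt (f u)) * (Num.sqrt (f v) - Num.sqrt (f u)).
  rewrite -[in LHS](@sqr_sqrtr _ (f v)) ?(le_trans _ cv) ?ltW//.
  by rewrite -[in LHS](@sqr_sqrtr _ (f u)) ?(le_trans _ cu) ?ltW//; ring.
rewrite normrM ler_wpM2r// ger0_norm ?addr_ge0 ?sqrtr_ge0//.
by rewrite ler_wpDl// sqrtr_ge0.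
Qed.

Lemma ac_expRN (a b : R) f : ac a b f ->
  (forall x, a <= x -> x <= b -> 0 <= f x) -> ac a b (fun x => expR (- f x)).
Proof.
move=> fac f0; apply: (ac_lipschitz (C := 1) fac) => u v au uv vb.
have fu := f0 _ au (le_trans uv vb); have fv := f0 _ (le_trans au uv) vb.
rewrite mul1r; move: (f u) (f v) fu fv => {u v au uv vb} p q p0 q0.
wlog pq : p q p0 q0 / p <= q => [th|].
  have [pq|/ltW qp] := leP p q; first exact: th.
  by rewrite distrC [leRHS]distrC; exact: th.
rewrite distrC !ger0_norm ?subr_ge0// ?ler_expR ?lerN2//.
(* Factoring out [expR (- p) <= 1] leaves [1 - expR (p - q) <= q - p], the tangent inequality at
   0. *)
have -> : - q = - p + (p - q) by ring.
rewrite expRD -[X in X - _]mulr1 -mulrBr.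
have e1 : expR (- p) <= 1 by rewrite -expR0 ler_expR oppr_le0.
have := expR_ge1Dx (p - q); have := expR_gt0 (- p).
have e2 : expR (p - q) <= 1 by rewrite -expR0 ler_expR subr_le0.
move: (expR _) (expR (p - q)) e1 e2 => x y; nra.
Qed.

(* [q], [w], [s], [z] stand for the square roots of [rho], [E], [eps] and for the
   integral of the square root of [rho]; [y] for the square root of [rho + E]. *)
Lemma gronwall_pointwise (q w s y z e k k1 k2 d : R) :
  0 <= q -> q <= y -> 0 < s -> s <= w -> w <= y -> 0 <= z -> 0 <= e -> 0 <= k ->
  k1 / 2 <= k -> k2 / 2 <= k ->
  d <= e + s ^+ 2 + k1 * q ^+ 2 + k2 * q * z ->
  (d + e) / (2 * y) + q <= e / w + s / 2 + (k + 1) * (y + z).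
Proof.
move=> q0 qy s0 sw wy z0 e0 k0 k1k k2k dle.
have y0 : 0 < y by rewrite (lt_le_trans s0)// (le_trans sw).
have w0 : 0 < w by rewrite (lt_le_trans s0).
have ey : e / y <= e / w by rewrite ler_wpM2l// lef_pV2.
(* The summand 1 in [k + 1] absorbs [q <= y]. Both [d] and [E'] contribute an [e], whence the full
   [e / y]. *)
suff : (d + e) / (2 * y) <= e / y + s / 2 + k * y + k * z by lra.
rewrite ler_pdivrMr ?mulr_gt0//.
have -> : (e / y + s / 2 + k * y + k * z) * (2 * y) =
    2 * e + s * y + 2 * k * y ^+ 2 + 2 * k * z * y by field; rewrite gt_eqF.
have s2 : s ^+ 2 <= s * y by rewrite expr2 ler_pM2l// (le_trans sw).
have q2 : q ^+ 2 <= y ^+ 2 by rewrite ler_sqr ?nnegrE// ltW.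
have t1 : k1 * q ^+ 2 <= 2 * k * y ^+ 2.
  by rewrite (le_trans (ler_wpM2r (sqr_ge0 q) (_ : k1 <= 2 * k)))//;
    [lra|rewrite ler_wpM2l// mulr_ge0].
have t2 : k2 * q * z <= 2 * k * z * y.
  rewrite mulrAC (mulrAC _ z y) -!mulrA [X in _ <= _ * (_ * X)]mulrC.
  apply: (@le_trans _ _ (2 * k * (z * q))).
    by rewrite ler_wpM2r ?mulr_ge0//; lra.
  by rewrite -mulrA ler_wpM2l// ler_wpM2l// ler_wpM2l.
lra.
Qed.

(** The exponential from [s] to [t] is written as [expR (A t) * expR (- A s)] and the first factor
    is pulled out of the integrals, so the bound is [h t <= h a] solved for [y t + z t]. *)
Lemma borel_gronwall (a b : R) (rho K1 K2 e k : R -> R) (eps : R) :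
  a < b -> 0 < eps -> ac a b rho -> (forall x, a <= x -> x <= b -> 0 <= rho x) ->
  mu.-integrable `[a, b] (EFin \o e) -> (forall x, 0 <= e x) ->
  mu.-integrable `[a, b] (EFin \o k) -> (forall x, 0 <= k x) ->
  let sq x := Num.sqrt (rho x) in
  let A := primitive a (fun x => k x + 1) in
  let E x := primitive a e x + eps in
  {ae mu, forall x, a <= x <= b -> K1 x / 2 <= k x /\ K2 x / 2 <= k x} ->
  {ae mu, forall x, a <= x <= b -> rho^`() x <=
    e x + eps + K1 x * rho x + K2 x * sq x * primitive a sq x} ->
  forall t, a <= t -> t <= b ->
  Num.sqrt (rho t) <=
    expR (A t) * (Num.sqrt (rho a + eps) - 2 * Num.sqrt eps
    + Num.sqrt eps / 2 * primitive a (fun x => expR (- A x)) t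
    + 2 * primitive a (fun x => (k x + 1) * (expR (- A x) * Num.sqrt (E x))) t)
    + 2 * Num.sqrt (E t).
Proof.
move=> ab eps0 rhoac rho0 ei e0 ki k0 sq A E Kk Hrho t a_t tb.
have ab' := ltW ab.
have mD : measurable (`[a, b] : set (measurableTypeR R)) by exact: measurable_itv.
have s0 : 0 < Num.sqrt eps by rewrite sqrtr_gt0.
have k1i : mu.-integrable `[a, b] (EFin \o (fun x => k x + 1)).
  have := integrableD mD ki (ac_integrable (ac_cst a b 1)); exact: eq_integrable.
have Aac : ac a b A by exact: ac_primitive.
have A0 x : 0 <= A x by apply: primitive_ge0 => y; rewrite addr_ge0.
have Eac : ac a b E by apply: acD (ac_cst a b eps); exact: ac_primitive.
have E0 x : eps <= E x by rewrite /E lerDr; exact: primitive_ge0.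
pose y x := Num.sqrt (rho x + E x); pose w x := Num.sqrt (E x).
have yac : ac a b y.
  apply: (ac_sqrt eps0 (acD rhoac Eac)) => x ax xb /=.
  by rewrite ler_wpDl// rho0.
have wac : ac a b w by apply: (ac_sqrt eps0 Eac).
have sqac : mu.-integrable `[a, b] (EFin \o sq) by exact: ac_sqrt_integrable.
pose z := primitive a sq; have zac : ac a b z by exact: ac_primitive.
have z0 x : 0 <= z x by apply: primitive_ge0 => u; exact: sqrtr_ge0.
pose D x := expR (- A x); have Dac : ac a b D by exact: ac_expRN.
pose B := primitive a D.
have Di := ac_integrable Dac; have Bac : ac a b B by exact: ac_primitive.
pose g x := (k x + 1) * (D x * w x).
have gi : mu.-integrable `[a, b] (EFin \o g).
  exact: integrableM_ac k1i (acM ab' Dac wac).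
pose G := primitive a g; have Gac : ac a b G by exact: ac_primitive.
(* [D] is the integrating factor. Differentiating [- 2 * D * w] gives the wanted [- 2 * D * w'] and
   an extra [2 * (k + 1) * D * w], which [- 2 * G] cancels: this is the integration by parts. *)
pose h x := D x * (y x + z x - 2 * w x) - Num.sqrt eps / 2 * B x - 2 * G x.
have hac : ac a b h.
  apply: acB (acZ _ Gac); apply: acB (acZ _ Bac).
  apply: (acM ab' Dac); apply: acB (acZ _ wac).
  exact: acD.
have [rho' [_ _ drho]] := ac_ftc ab rhoac.
have htha : h t <= h a.
  apply: ac_nonincreasing => //; first exact: acS hac.
  have dA := is_derive_primitive k1i; have dE := is_derive_primitive ei.
  have dz := is_derive_primitive sqac; have dB := is_derive_primitive Di.
  have dG := is_derive_primitive gi.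
  have := ae_and drho (ae_and dA (ae_and dE (ae_and dz (ae_and dB
    (ae_and dG (ae_and Kk Hrho)))))).
  apply: ae_impl => x [/= {}drho [{}dA [{}dE [{}dz [{}dB [{}dG [{}Kk {}Hrho]]]]]]].
  move=> /andP[ax xt] d dh.
  have xab : a < x < b by rewrite ax (lt_le_trans xt).
  have xab' : a <= x <= b by case/andP: xab => /ltW -> /ltW ->.
  have {}drho := drho xab; have {}dA := dA xab; have {}dE := dE xab.
  have {}dz := dz xab; have {}dB := dB xab; have {}dG := dG xab.
  have [K1k K2k] := Kk xab'; have {}Hrho := Hrho xab'.
  have rhox : 0 <= rho x by apply: rho0; case/andP: xab'.
  have Ex : 0 < E x by rewrite (lt_le_trans eps0).
  have rE0 : 0 < rho x + E x by rewrite ltr_wpDl.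
  have dE' : is_derive x 1 E (e x).
    by rewrite -[e x]addr0; apply: is_deriveD.
  have dw : is_derive x 1 w ((2 * w x)^-1 * e x).
    by apply: is_derive1_comp; exact: is_derive1_sqrt.
  have dy : is_derive x 1 y ((2 * y x)^-1 * (rho' x + e x)).
    apply: (@is_derive1_comp _ _ (rho \+ E)); first exact: is_derive1_sqrt.
  have dD : is_derive x 1 D (D x * - (k x + 1)).
    by apply: is_derive1_comp; exact: is_deriveN.
  have dh0 : is_derive x 1 h (D x *: ((2 * y x)^-1 * (rho' x + e x) + sq x
        - 2 *: ((2 * w x)^-1 * e x))
      + (y x + z x - 2 *: w x) *: (D x * - (k x + 1))
      - Num.sqrt eps / 2 *: D x - 2 *: g x).
    exact: (is_deriveB (is_deriveB (is_deriveM dD (is_deriveB (is_deriveD dy dz)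
      (is_deriveZ 2 dw))) (is_deriveZ (Num.sqrt eps / 2) dB)) (is_deriveZ 2 dG)).
  (* Uniqueness of the derivative identifies [d] with the computed value. *)
  rewrite -[d](@derive_val _ _ _ _ _ _ _ dh) (@derive_val _ _ _ _ _ _ _ dh0).
  rewrite derive1E (@derive_val _ _ _ _ _ _ _ drho) in Hrho.
  have ptw : (rho' x + e x) / (2 * y x) + sq x <=
      e x / w x + Num.sqrt eps / 2 + (k x + 1) * (y x + z x).
    apply: (gronwall_pointwise (k1 := K1 x) (k2 := K2 x)) => //.
    - exact: sqrtr_ge0.
    - by apply: ler_wsqrtr; rewrite lerDl ltW.
    - by apply: ler_wsqrtr; exact: E0.
    - by apply: ler_wsqrtr; rewrite lerDr.
    - by rewrite !sqr_sqrtr// ltW.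
  have D0 : 0 < D x := expR_gt0 _.
  have w0 : 0 < w x by rewrite sqrtr_gt0.
  have -> : 2 *: ((2 * w x)^-1 * e x) = e x / w x.
    by rewrite /GRing.scale/= invfM mulrA mulrA divff// mul1r mulrC.
  rewrite /GRing.scale/= /g mulrC [_^-1 * _]mulrC.
  rewrite [leLHS](_ : _ = D x * ((rho' x + e x) / (2 * y x) + sq x - (e x / w x
     + Num.sqrt eps / 2 + (k x + 1) * (y x + z x)))); last by ring.
  by rewrite pmulr_rle0// subr_le0.
have yz : Num.sqrt (rho t) <= y t + z t.
  rewrite ler_wpDr//; apply: ler_wsqrtr; rewrite lerDl.
  by rewrite (le_trans (ltW eps0)).
apply: (le_trans yz).
(* At [a] all primitives vanish, so [D] is 1 and [E] is [eps]. *)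
have ha : h a = Num.sqrt (rho a + eps) - 2 * Num.sqrt eps.
  rewrite /h /D /y /w /z /B /G /A /E !primitive_left oppr0 expR0 !add0r; ring.
rewrite -lerBlDr -ler_pdivrMl ?expR_gt0// -expRN -/(D t).
rewrite -[primitive a (fun x => expR _) t]/(B t).
rewrite -[primitive a (fun x => _ * _) t]/(G t).
by move: htha; rewrite ha {1}/h -/(w t); lra.
Qed.

End gronwall.

(** * Transfer to the completed Lebesgue measure *)

Lemma completed_Rintegral_itv (R : realType) (a b : R) (f g : R -> R) :
  lebesgue_measure.-integrable `[a, b] (EFin \o g) ->
  {ae (@lebesgue_measure R), forall x, a <= x <= b -> f x = g x} ->
  \int[lebmu R]_(x in `[a, b]) f x = \int[lebesgue_measure]_(x in `[a, b]) g x.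
Proof.
move=> /integrableP[/measurable_EFinP mg _] fg.
by congr fine; apply: completed_integral_ae_eq.
Qed.

Theorem lemma3p3 (R : realType) (T0 T : R)
  (rho K1 K2 epsf K : R -> R) (eps : R)
  (hT : T0 < T)
  (rho_ge0 : forall t, T0 <= t <= T -> 0 <= rho t)
  (rho_ac : absolutely_continuous T0 T rho)
  (K1_ge0 : forall t, T0 <= t <= T -> 0 <= K1 t)
  (K1_int : (lebmu R).-integrable `[T0, T] (EFin \o K1))
  (K2_ge0 : forall t, T0 <= t <= T -> 0 <= K2 t)
  (K2_int : (lebmu R).-integrable `[T0, T] (EFin \o K2))
  (epsf_ge0 : forall t, T0 <= t <= T -> 0 <= epsf t)
  (epsf_int : (lebmu R).-integrable `[T0, T] (EFin \o epsf))
  (eps_gt0 : 0 < eps)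
  (hrho : {ae lebmu R, forall t : R, T0 <= t <= T ->
     rho^`() t <= epsf t + eps + K1 t * rho t
       + K2 t * Num.sqrt (rho t) * \int[lebmu R]_(s in `[T0, t]) Num.sqrt (rho s)})
  (hK : {ae lebmu R, forall t : R, T0 <= t <= T ->
     K t = Num.max (K1 t / 2) (K2 t / 2)}) :
  forall t : R, T0 <= t <= T ->
    Num.sqrt (rho t) <=
      Num.sqrt (rho T0 + eps)
        * expR (\int[lebmu R]_(s in `[T0, t]) (K s + 1))
    + Num.sqrt eps / 2
        * \int[lebmu R]_(s in `[T0, t])
            expR (\int[lebmu R]_(tau in `[s, t]) (K tau + 1))
    + 2 * (Num.sqrt (\int[lebmu R]_(s in `[T0, t]) epsf s + eps)
           - Num.sqrt eps * expR (\int[lebmu R]_(tau in `[T0, t]) (K tau + 1)))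
    + 2 * \int[lebmu R]_(s in `[T0, t])
            ((K s + 1)
             * expR (\int[lebmu R]_(tau in `[s, t]) (K tau + 1))
             * Num.sqrt (\int[lebmu R]_(tau in `[T0, s]) epsf tau + eps)).
Proof.
move=> t /andP[T0t tT].
have mD : measurable (`[T0, T] : set (measurableTypeR R)) by exact: measurable_itv.
have itvP x : T0 <= x <= T -> `[T0, T]%classic x by rewrite /= in_itv.
have repr f : (forall x, T0 <= x <= T -> 0 <= f x) ->
    (lebmu R).-integrable `[T0, T] (EFin \o f) -> exists g : R -> R,
    [/\ lebesgue_measure.-integrable `[T0, T] (EFin \o g), forall x, 0 <= g x &
      {ae (@lebesgue_measure R), forall x, T0 <= x <= T -> f x = g x}].
  move=> f0 fi.
  have [|g [_ gi g0 fg]] := completed_integrable_representative mD fi.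
    by move=> x; rewrite /= in_itv; exact: f0.
  by exists g; split => //; apply: ae_impl fg => x fg /itvP.
have [k1 [k1i k10 K1k]] := repr _ K1_ge0 K1_int.
have [k2 [k2i k20 K2k]] := repr _ K2_ge0 K2_int.
have [e [ei e0 epse]] := repr _ epsf_ge0 epsf_int.
(* The Borel counterpart of [K], integrable because it is dominated by [k1 + k2]. *)
pose k x := Num.max (k1 x / 2) (k2 x / 2).
have k0 x : 0 <= k x by rewrite le_max divr_ge0.
have ki : lebesgue_measure.-integrable `[T0, T] (EFin \o k).
  apply: (le_integrable mD _ _ (integrableD mD k1i k2i)).
    have /integrableP[/measurable_EFinP mk1 _] := k1i.
    have /integrableP[/measurable_EFinP mk2 _] := k2i.
    apply/measurable_EFinP; apply: measurable_maxr; exact: measurable_funM.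
  move=> x _ /=; rewrite lee_fin !ger0_norm ?addr_ge0// ge_max.
  by have := k10 x; have := k20 x; move=> ? ?; apply/andP; split; lra.
have Kk : {ae (@lebesgue_measure R), forall x, T0 <= x <= T -> K x = k x}.
  move/completed_aeE : hK => hK.
  apply: ae_impl (ae_and hK (ae_and K1k K2k)) => x [hK' [K1x K2x]] xT.
  by rewrite hK'// K1x// K2x.
have rhoac := ac_absolutely_continuous rho_ac.
have rho0 x : T0 <= x -> x <= T -> 0 <= rho x by move=> *; apply/rho_ge0/andP.
have sub f x y : T0 <= x -> y <= T ->
    lebesgue_measure.-integrable `[T0, T] (EFin \o f) ->
    lebesgue_measure.-integrable `[x, y] (EFin \o f).
  move=> T0x yT; apply: integrableS => //.
  by apply: subset_itv; rewrite bnd_simp.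
pose sq x := Num.sqrt (rho x); pose A := primitive T0 (fun x => k x + 1).
pose E x := primitive T0 e x + eps.
have sqi : lebesgue_measure.-integrable `[T0, T] (EFin \o sq).
  exact: ac_sqrt_integrable.
have K12k : {ae (@lebesgue_measure R), forall x, T0 <= x <= T ->
    K1 x / 2 <= k x /\ K2 x / 2 <= k x}.
  apply: ae_impl (ae_and K1k K2k) => x [K1x K2x] xT.
  by rewrite K1x// K2x// /k !le_max !lexx orbT.
have Hrho : {ae (@lebesgue_measure R), forall x, T0 <= x <= T -> rho^`() x <=
    e x + eps + K1 x * rho x + K2 x * sq x * primitive T0 sq x}.
  move/completed_aeE : hrho => hrho.
  apply: ae_impl (ae_and hrho epse) => x [hrho' epsx] xT.
  have := hrho' xT; rewrite epsx// (@completed_Rintegral_itv _ _ _ _ sq)//.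
    by apply: sub => //; case/andP: xT.
  exact: aeW.
have := borel_gronwall hT eps_gt0 rhoac rho0 ei e0 ki k0 K12k Hrho T0t tT.
rewrite -/sq -/A -/E.
have k1int : lebesgue_measure.-integrable `[T0, T] (EFin \o (fun x => k x + 1)).
  have := integrableD mD ki (ac_integrable (ac_cst T0 T 1)); exact: eq_integrable.
(* Every exponent becomes a difference of values of [A], which separates the dependence on [t] from
   that on the integration variable. *)
have AE s u : T0 <= s -> s <= u -> u <= T ->
    \int[lebmu R]_(x in `[s, u]) (K x + 1) = A u - A s.
  move=> T0s su uT; rewrite /A (@primitive_restrict _ _ T _ u)//.
  rewrite (@primitive_restrict _ _ T _ s) ?(le_trans su)//.
  rewrite primitiveB//; last exact: integrable_restrict_setT.
  have sD : `]s, u]%classic `<=` `[T0, T]%classic.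
    by apply: subset_itv; rewrite bnd_simp.
  rewrite Rintegral_itv_obnd_cbnd; last first.
    apply: integrable_sub_itv; first exact: measurable_itv.
    exact: integrable_restrict_setT.
  rewrite (completed_Rintegral_itv (sub _ _ _ T0s uT k1int)); last first.
    apply: ae_impl Kk => x Kx /andP[sx xu].
    by rewrite Kx// (le_trans T0s)// (le_trans xu).
  apply: eq_Rintegral => x; rewrite inE/= in_itv/= => /andP[sx xu].
  by rewrite /patch mem_set//= in_itv/= (le_trans T0s)// (le_trans xu).
have AE0 u : T0 <= u -> u <= T -> \int[lebmu R]_(x in `[T0, u]) (K x + 1) = A u.
  by move=> T0u uT; rewrite AE// /A primitive_left subr0.
have EE u : T0 <= u -> u <= T -> \int[lebmu R]_(x in `[T0, u]) epsf x + eps = E u.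
  move=> T0u uT; congr (_ + _); apply: completed_Rintegral_itv; first exact: sub.
  apply: ae_impl epse => x epsx /andP[T0x xu].
  by rewrite epsx// T0x (le_trans xu).
have Aac : ac T0 T A by exact: ac_primitive.
have Dac : ac T0 T (fun x => expR (- A x)).
  by apply: ac_expRN => // x _ _; apply: primitive_ge0 => y; rewrite addr_ge0.
have Eac : ac T0 T (fun x => Num.sqrt (E x)).
  apply: (ac_sqrt eps_gt0 (acD (ac_primitive ei) (ac_cst T0 T eps))) => x _ _ /=.
  by rewrite lerDr; exact: primitive_ge0.
(* The inner integrals are exact for each [s], so here the two integrands agree everywhere on the
   interval. *)
have -> : \int[lebmu R]_(s in `[T0, t])
    expR (\int[lebmu R]_(tau in `[s, t]) (K tau + 1)) =
    expR (A t) * primitive T0 (fun x => expR (- A x)) t.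
  have Di := sub _ _ _ (lexx T0) tT (ac_integrable Dac).
  rewrite -RintegralZl//; apply: completed_Rintegral_itv.
    exact: (sub _ _ _ (lexx T0) tT (ac_integrable (acZ _ Dac))).
  by apply: aeW => s /andP[T0s st]; rewrite AE// expRD.
have -> : \int[lebmu R]_(s in `[T0, t])
    ((K s + 1) * expR (\int[lebmu R]_(tau in `[s, t]) (K tau + 1)) *
     Num.sqrt (\int[lebmu R]_(tau in `[T0, s]) epsf tau + eps)) =
    expR (A t) * primitive T0
      (fun x => (k x + 1) * (expR (- A x) * Num.sqrt (E x))) t.
  have gac := acM (ltW hT) Dac Eac.
  have gi := sub _ _ _ (lexx T0) tT (integrableM_ac (ltW hT) k1int gac).
  rewrite -RintegralZl//; apply: completed_Rintegral_itv.
    have gac' := acZ (expR (A t)) gac.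
    have := sub _ _ _ (lexx T0) tT (integrableM_ac (ltW hT) k1int gac').
    by apply: eq_integrable => // x _ /=; congr EFin; ring.
  (* The factor [K s + 1] stands outside any inner integral, so the integrands agree only almost
     everywhere. *)
  apply: ae_impl Kk => s Ks /andP[T0s st].
  by rewrite Ks ?T0s ?(le_trans st)// AE// EE ?(le_trans st)// expRD; ring.
rewrite AE0// EE//; lra.
Qed.
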